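(* Let $a:\mathbb{R}\to\mathbb{R}$ be a smooth $2\pi$-periodic function with average $\bar a=\frac{1}{2\pi}\int_0^{2\pi}a(s)\,ds$, let $F(x,t)$ be a real-valued function of $(x,t)\in\mathbb{R}\times\mathbb{R}$, and define $$\gamma(t)=\exp\Bigl(-\frac12\int_0^t\bigl(a(s)-\bar a\bigr)\,ds\Bigr).$$ Then $\gamma$ is $2\pi$-periodic with $\gamma(0)=\gamma(2\pi)=1$. If $x(t)$ satisfies $$\frac{d^2x(t)}{dt^2}+a(t)\frac{dx(t)}{dt}+F(x(t),t)=0,$$ then the function $y(t)$ defined by $x(t)=\gamma(t)y(t)$ satisfies the equation with averaged dissipation $$\frac{d^2y(t)}{dt^2}+\bar a\,\frac{dy(t)}{dt}+G(y(t),t)=0,$$ where $$G(y,t)=\frac{\gamma''(t)+a(t)\gamma'(t)}{\gamma(t)}\,y+\frac{1}{\gamma(t)}F(\gamma(t)y,t).$$ Moreover, $$x(0)=y(0),\qquad x(2\pi)=y(2\pi),$$ $$y'(0)=x'(0)+\tfrac12\bigl(a(0)-\bar a\bigr)x(0),\qquad y'(2\pi)=x'(2\pi)+\tfrac12\bigl(a(2\pi)-\bar a\bigr)x(2\pi).$$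
   Context: Primes denote derivatives with respect to $t$. *)

(* Defs.v *)
From Stdlib Require Import Reals.
From Coquelicot Require Import Coquelicot.
Open Scope R_scope.

Definition smooth (f : R -> R) : Prop :=
  forall (n : nat) (t : R), ex_derive_n f n t.

Definition periodic (f : R -> R) (T : R) : Prop :=
  forall t : R, f (t + T) = f t.

Definition average (a : R -> R) : R :=
  1 / (2 * PI) * RInt a 0 (2 * PI).

Definition gamma (a : R -> R) (t : R) : R :=
  exp (- (1 / 2) * RInt (fun s => a s - average a) 0 t).

Definition G (a : R -> R) (F : R -> R -> R) (y t : R) : R :=
  (Derive_n (gamma a) 2 t + a t * Derive (gamma a) t) / gamma a t * y
  + 1 / gamma a t * F (gamma a t * y) t.

Definition in_interval (lo hi : Rbar) (t : R) : Prop :=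
  Rbar_lt lo t /\ Rbar_lt t hi.

(* u'' + b(t) u' + H(u,t) = 0 on the open interval (lo, hi), whose endpoints
   may be infinite.  As [Derive] is total, the existence of u' and u'' is part
   of being a solution. *)
Definition solves_on (lo hi : Rbar) (b : R -> R) (H : R -> R -> R)
    (u : R -> R) : Prop :=
  forall t : R, in_interval lo hi t ->
    ex_derive u t /\ ex_derive_n u 2 t /\
    Derive_n u 2 t + b t * Derive u t + H (u t) t = 0.

(* Main.v *)
Require Import Defs.
From Stdlib Require Import Reals Lra.
From Coquelicot Require Import Coquelicot.
Open Scope R_scope.

(** The factor [gamma a] solves the first-order equation
    [gamma' = - (1/2) (a - average a) gamma] with [gamma 0 = 1].  Dividing by it
    therefore changes the friction coefficient from [a] to
    [a + 2 gamma' / gamma = average a], while the terms in [gamma'] and [gamma'']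
    that are proportional to [y] are collected in [G]; this is the Liouville
    substitution.  The formulas for [gamma'] and [gamma''] are
    [is_derive_gamma] and [Derive_n_gamma_2], those for the derivatives of
    [y = x / gamma] are [is_derive_quotient] and [is_derive_2_quotient].
    Since [a - average a] is periodic with mean zero, its primitive from [0] is
    [2 * PI]-periodic, hence so is [gamma a] ([gamma_periodic]), which thus equals
    [1] at both [0] and [2 * PI]; there [transformed_at_gamma_1] compares the
    values and velocities of [x] and [y]. *)

(** The logarithmic derivative of [gamma a]. *)
Definition log_slope (a : R -> R) (t : R) : R := - (1 / 2) * (a t - average a).

Lemma smooth_ex_derive (a : R -> R) (t : R) : smooth a -> ex_derive a t.
Proof. intros Ha; exact (Ha 1%nat t). Qed.

Lemma smooth_continuous (a : R -> R) (t : R) : smooth a -> continuous a t.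
Proof.
  intros Ha; apply (ex_derive_continuous (V := R_NormedModule)).
  now apply smooth_ex_derive.
Qed.

Lemma continuous_fluctuation (a : R -> R) (t : R) :
  smooth a -> continuous (fun s => a s - average a) t.
Proof.
  intros Ha.
  apply (continuous_minus (V := R_NormedModule)).
  - now apply smooth_continuous.
  - apply continuous_const.
Qed.

Lemma ex_RInt_fluctuation (a : R -> R) (u v : R) :
  smooth a -> ex_RInt (fun s => a s - average a) u v.
Proof.
  intros Ha; apply (ex_RInt_continuous (V := R_CompleteNormedModule)).
  intros; now apply continuous_fluctuation.
Qed.

Lemma gamma_pos (a : R -> R) (t : R) : 0 < gamma a t.
Proof. apply exp_pos. Qed.

Lemma gamma_0 (a : R -> R) : gamma a 0 = 1.
Proof.
  unfold gamma; rewrite RInt_point; change (zero : R) with 0.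
  now rewrite Rmult_0_r, exp_0.
Qed.

Lemma RInt_fluctuation_period (a : R -> R) :
  smooth a -> RInt (fun s => a s - average a) 0 (2 * PI) = 0.
Proof.
  intros Ha.
  assert (HPI := PI_RGT_0).
  transitivity (minus (RInt a 0 (2 * PI)) (RInt (fun _ => average a) 0 (2 * PI))).
  - apply (RInt_minus (V := R_CompleteNormedModule)).
    + apply (ex_RInt_continuous (V := R_CompleteNormedModule)).
      intros; now apply smooth_continuous.
    + apply (ex_RInt_const (V := R_NormedModule)).
  - rewrite RInt_const.
    unfold minus, plus, opp, scal, average; simpl; unfold mult; simpl.
    field; lra.
Qed.

Lemma gamma_periodic (a : R -> R) :
  smooth a -> periodic a (2 * PI) -> periodic (gamma a) (2 * PI).
Proof.
  intros Ha Hp t; unfold gamma; do 2 f_equal.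
  rewrite <- (RInt_Chasles (V := R_CompleteNormedModule)
                (fun s => a s - average a) 0 (2 * PI) (t + 2 * PI))
    by now apply ex_RInt_fluctuation.
  rewrite (RInt_fluctuation_period a Ha).
  rewrite (plus_zero_l (G := R_AbelianMonoid)).
  assert (E := RInt_comp_lin (V := R_CompleteNormedModule)
                 (fun s => a s - average a) 1 (2 * PI) 0 t).
  replace (1 * 0 + 2 * PI) with (2 * PI) in E by ring.
  replace (1 * t + 2 * PI) with (t + 2 * PI) in E by ring.
  rewrite <- E by now apply ex_RInt_fluctuation.
  apply RInt_ext; intros s _.
  unfold scal; simpl; unfold mult; simpl.
  rewrite !Rmult_1_l.
  now rewrite (Hp s).
Qed.

Lemma is_derive_gamma (a : R -> R) (t : R) :
  smooth a -> is_derive (gamma a) t (log_slope a t * gamma a t).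
Proof.
  intros Ha; unfold gamma, log_slope.
  apply (is_derive_comp exp (fun t => - (1 / 2) * RInt (fun s => a s - average a) 0 t)).
  - apply is_derive_exp.
  - apply is_derive_scal.
    apply (is_derive_RInt (V := R_NormedModule) (fun s => a s - average a) _ 0).
    + apply filter_forall; intros u.
      apply (RInt_correct (V := R_CompleteNormedModule)).
      now apply ex_RInt_fluctuation.
    + now apply continuous_fluctuation.
Qed.

Lemma Derive_gamma (a : R -> R) (t : R) :
  smooth a -> Derive (gamma a) t = log_slope a t * gamma a t.
Proof. intros Ha; apply is_derive_unique; now apply is_derive_gamma. Qed.

Lemma is_derive_log_slope (a : R -> R) (t : R) :
  smooth a -> is_derive (log_slope a) t (- (1 / 2) * Derive a t).
Proof.
  intros Ha; unfold log_slope.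
  auto_derive.
  - now apply smooth_ex_derive.
  - change (Derive (fun s => a s) t) with (Derive a t); ring.
Qed.

Lemma Derive_n_gamma_2 (a : R -> R) (t : R) :
  smooth a ->
  Derive_n (gamma a) 2 t
  = (- (1 / 2) * Derive a t + log_slope a t * log_slope a t) * gamma a t.
Proof.
  intros Ha; change (Derive (Derive (gamma a)) t
    = (- (1 / 2) * Derive a t + log_slope a t * log_slope a t) * gamma a t).
  rewrite (Derive_ext _ (fun s => log_slope a s * gamma a s))
    by (intros; now apply Derive_gamma).
  assert (Hl := is_derive_log_slope a t Ha).
  assert (Hg := is_derive_gamma a t Ha).
  rewrite Derive_mult by (eexists; eassumption).
  rewrite (is_derive_unique _ _ _ Hl), (is_derive_unique _ _ _ Hg); ring.
Qed.

Lemma is_derive_quotient (a u : R -> R) (t : R) :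
  smooth a -> ex_derive u t ->
  is_derive (fun s => u s / gamma a s) t
    ((Derive u t - log_slope a t * u t) / gamma a t).
Proof.
  intros Ha Hu.
  assert (Hpos := gamma_pos a t).
  assert (Hg := is_derive_gamma a t Ha).
  evar_last.
  - apply is_derive_div; [apply Derive_correct, Hu | exact Hg | lra].
  - simpl; field; lra.
Qed.

Lemma is_derive_2_quotient (a u : R -> R) (t : R) :
  smooth a -> ex_derive u t -> ex_derive_n u 2 t ->
  is_derive (fun s => (Derive u s - log_slope a s * u s) / gamma a s) t
    ((Derive_n u 2 t - 2 * log_slope a t * Derive u t
      + (1 / 2 * Derive a t + log_slope a t * log_slope a t) * u t)
     / gamma a t).
Proof.
  intros Ha Hu Hu2.
  assert (Hpos := gamma_pos a t).
  assert (Hn : is_derive (fun s => Derive u s - log_slope a s * u s) t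
    (Derive_n u 2 t - (- (1 / 2) * Derive a t * u t + log_slope a t * Derive u t))).
  { apply (is_derive_minus (V := R_NormedModule)).
    - apply (Derive_correct (Derive u)), Hu2.
    - apply (is_derive_mult (log_slope a) u).
      + now apply is_derive_log_slope.
      + now apply Derive_correct.
      + exact Rmult_comm. }
  evar_last.
  - apply is_derive_quotient; [exact Ha | eexists; exact Hn].
  - rewrite (is_derive_unique _ _ _ Hn); field; lra.
Qed.

Lemma in_interval_locally (lo hi : Rbar) (t : R) :
  in_interval lo hi t -> locally t (in_interval lo hi).
Proof.
  apply (open_and (fun s : R => Rbar_lt lo s) (fun s : R => Rbar_lt s hi)).
  - apply open_Rbar_gt.
  - apply open_Rbar_lt.
Qed.

Lemma is_derive_transformed (a b x y : R -> R) (F : R -> R -> R)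
    (lo hi : Rbar) (t : R) :
  smooth a -> solves_on lo hi b F x ->
  (forall s, in_interval lo hi s -> x s = gamma a s * y s) ->
  in_interval lo hi t ->
  is_derive y t ((Derive x t - log_slope a t * x t) / gamma a t).
Proof.
  intros Ha Hx Hxy Ht.
  apply (is_derive_ext_loc (fun s => x s / gamma a s)).
  - apply filter_imp with (2 := in_interval_locally _ _ _ Ht); intros s Hs.
    rewrite (Hxy s Hs).
    change (gamma a s * y s / gamma a s = y s); field; apply Rgt_not_eq, gamma_pos.
  - apply is_derive_quotient; [exact Ha | apply (Hx t Ht)].
Qed.

Lemma is_derive_2_transformed (a b x y : R -> R) (F : R -> R -> R)
    (lo hi : Rbar) (t : R) :
  smooth a -> solves_on lo hi b F x ->
  (forall s, in_interval lo hi s -> x s = gamma a s * y s) ->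
  in_interval lo hi t ->
  is_derive (Derive y) t
    ((Derive_n x 2 t - 2 * log_slope a t * Derive x t
      + (1 / 2 * Derive a t + log_slope a t * log_slope a t) * x t)
     / gamma a t).
Proof.
  intros Ha Hx Hxy Ht.
  apply (is_derive_ext_loc
           (fun s => (Derive x s - log_slope a s * x s) / gamma a s)).
  - apply filter_imp with (2 := in_interval_locally _ _ _ Ht); intros s Hs.
    symmetry; apply is_derive_unique.
    now apply (is_derive_transformed a b x y F lo hi).
  - destruct (Hx t Ht) as [Hx1 [Hx2 _]].
    now apply is_derive_2_quotient.
Qed.

(** At a time when [gamma a = 1], [x] and [y] agree, and since
    [x' = gamma' y + gamma y'] their velocities differ by [log_slope a t * x t]. *)
Lemma transformed_at_gamma_1 (a b x y : R -> R) (F : R -> R -> R)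
    (lo hi : Rbar) (t : R) :
  smooth a -> solves_on lo hi b F x ->
  (forall s, in_interval lo hi s -> x s = gamma a s * y s) ->
  in_interval lo hi t -> gamma a t = 1 ->
  x t = y t /\ Derive y t = Derive x t + 1 / 2 * (a t - average a) * x t.
Proof.
  intros Ha Hx Hxy Ht H1; split.
  - rewrite (Hxy t Ht), H1; ring.
  - rewrite (is_derive_unique _ _ _
               (is_derive_transformed a b x y F lo hi t Ha Hx Hxy Ht)), H1.
    unfold log_slope; field.
Qed.

Theorem mainTheorem2 (a : R -> R) (F : R -> R -> R)
    (a_smooth : smooth a) (a_periodic : periodic a (2 * PI)) :
  (periodic (gamma a) (2 * PI) /\ gamma a 0 = 1 /\ gamma a (2 * PI) = 1) /\
  forall (lo hi : Rbar) (x y : R -> R),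
    solves_on lo hi a F x ->
    (forall t : R, in_interval lo hi t -> x t = gamma a t * y t) ->
    solves_on lo hi (fun _ => average a) (G a F) y /\
    (in_interval lo hi 0 ->
       x 0 = y 0 /\
       Derive y 0 = Derive x 0 + 1 / 2 * (a 0 - average a) * x 0) /\
    (in_interval lo hi (2 * PI) ->
       x (2 * PI) = y (2 * PI) /\
       Derive y (2 * PI) =
         Derive x (2 * PI) + 1 / 2 * (a (2 * PI) - average a) * x (2 * PI)).
Proof.
  assert (Hper := gamma_periodic a a_smooth a_periodic).
  assert (H2pi : gamma a (2 * PI) = 1).
  { rewrite <- (Rplus_0_l (2 * PI)), (Hper 0); apply gamma_0. }
  split; [split; [exact Hper | split; [apply gamma_0 | exact H2pi]] |].
  intros lo hi x y Hx Hxy; split; [| split].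
  - intros t Ht.
    assert (D1 := is_derive_transformed a a x y F lo hi t a_smooth Hx Hxy Ht).
    assert (D2 := is_derive_2_transformed a a x y F lo hi t a_smooth Hx Hxy Ht).
    split; [eexists; exact D1 | split; [eexists; exact D2 |]].
    change (Derive_n y 2 t) with (Derive (Derive y) t).
    rewrite (is_derive_unique _ _ _ D1), (is_derive_unique _ _ _ D2).
    unfold G.
    rewrite (Derive_n_gamma_2 a t a_smooth), (Derive_gamma a t a_smooth).
    rewrite <- (Hxy t Ht).
    destruct (Hx t Ht) as [_ [_ Heq]].
    assert (Hpos := gamma_pos a t).
    replace (y t) with (x t / gamma a t) by (rewrite (Hxy t Ht); field; lra).
    (* The equation for [x] is solved for [F], leaving a rational identity. *)
    replace (F (x t) t) with (- Derive_n x 2 t - a t * Derive x t) by lra.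
    unfold log_slope; field; lra.
  - intros H0.
    now apply (transformed_at_gamma_1 a a x y F lo hi 0 a_smooth Hx Hxy H0), gamma_0.
  - intros H2.
    now apply (transformed_at_gamma_1 a a x y F lo hi (2 * PI) a_smooth Hx Hxy H2).
Qed.
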